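(* Let $p$ be a prime and $n,k$ positive integers with $k<n$. Any nonadaptive classical deterministic algorithm solving the generalized Simon's problem $\mathsf{GSP}(p,n,k)$ must make $\Omega\left(\max\{k,\sqrt{k\cdot p^{n-k}}\}\right)$ queries to $f$.
   Context: $\mathbb{Z}_p^n$ is the additive group of $n$-tuples over $\mathbb{Z}_p$ with componentwise addition mod $p$; its subgroups are exactly the $\mathbb{F}_p$-linear subspaces, and the rank of a subgroup is its dimension. The problem $\mathsf{GSP}(p,n,k)$: one is given oracle access to an unknown function $f:\mathbb{Z}_p^n\to X$, where $X$ is a finite set, with the promise that there is a subgroup $S\le\mathbb{Z}_p^n$ of rank $k$ such that for all $x,y\in\mathbb{Z}_p^n$, $f(x)=f(y)$ iff $x-y\in S$; the goal is to output $S$. A query returns $f(x)$ for a chosen $x$. A deterministic algorithm must always output $S$ correctly; it is nonadaptive if the set of points it queries does not depend on the answers to previous queries. The implied constants in $\Omega$ are absolute. *)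

(* Defs.v *)
From mathcomp Require Import all_boot all_order all_algebra.
From mathcomp Require Import all_fingroup all_solvable all_field all_character.
From mathcomp Require Import reals.

Set Implicit Arguments.
Unset Strict Implicit.
Unset Printing Implicit Defensive.

Import GRing.Theory.
Local Open Scope ring_scope.

(* Deterministic query algorithms as decision trees: the point queried next   *)
(* may depend on all the previous answers, and computation between queries is *)
(* free. Termination on every oracle is built in, the type being inductive.   *)
Inductive query_alg (D X O : Type) : Type :=
| Output of O
| Query of D & (X -> query_alg D X O).

Fixpoint run (D X O : Type) (A : query_alg D X O) (f : D -> X) : O :=
  match A with
  | Output o => o
  | Query x next => run (next (f x)) f
  end.

(* Repeated queries are listed (hence counted) with multiplicity.             *)
Fixpoint queries (D X O : Type) (A : query_alg D X O) (f : D -> X) : seq D :=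
  match A with
  | Output _ => [::]
  | Query x next => x :: queries (next (f x)) f
  end.

Definition nonadaptive (D : eqType) (X O : Type) (A : query_alg D X O) : Prop :=
  forall f g : D -> X, queries A f =i queries A g.

(* Here {group 'rV['F_p]_n} is the type of subgroups of the additive group of *)
(* 'rV['F_p]_n; for prime p they coincide with the subspaces, and rowg_mx S   *)
(* is a matrix whose row space is spanned by S.                               *)
Definition subgroup_rank (p n : nat) (S : {group 'rV['F_p]_n}) : nat :=
  \rank (rowg_mx S).

Definition hides (p n : nat) (X : Type) (f : 'rV['F_p]_n -> X)
    (S : {group 'rV['F_p]_n}) : Prop :=
  forall x y : 'rV['F_p]_n, f x = f y <-> x - y \in S.

Definition GSP_instance (p n k : nat) (X : Type) (f : 'rV['F_p]_n -> X) : Prop :=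
  exists S : {group 'rV['F_p]_n}, subgroup_rank S = k /\ hides f S.

Definition solves_GSP (p n k : nat) (X : Type)
    (A : query_alg 'rV['F_p]_n X {group 'rV['F_p]_n}) : Prop :=
  forall (f : 'rV['F_p]_n -> X) (S : {group 'rV['F_p]_n}),
    subgroup_rank S = k -> hides f S -> run A f = S.

(* Main.v *)
(* Let Q be the fixed set of queried points and D = Q - Q. If two rank-k
   subgroups S1, S2 have the same intersection with D, then the restriction to Q
   of a function hiding S1 extends to a function hiding S2, so the algorithm
   cannot tell them apart; hence S |-> D :&: S is injective on rank-k subgroups.
   Encoding S by a basis of the span of D :&: S chosen inside D :&: S,
   there are at most as many rank-k subgroups as subsets of D of size at most k.
   There are at least p ^ (k (n - k)) of the former and, for every x in ]0, 1],
   at most (1 + x) ^ #|D| / x ^ k of the latter; x = k / |Q|^2 gives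
   k p ^ (n - k) <= e |Q|^2. Finally |Q| < k is impossible, as then two
   different rank-k subgroups would contain Q. *)

Require Import Defs.
From mathcomp Require Import all_boot all_order all_algebra.
From mathcomp Require Import all_fingroup all_solvable all_field all_character.
From mathcomp Require Import reals.
From mathcomp Require Import sequences exp.

Set Implicit Arguments.
Unset Strict Implicit.
Unset Printing Implicit Defensive.

Import Order.TTheory GRing.Theory Num.Theory.
Local Open Scope ring_scope.

(** * Runs that agree on the queried points, and functions with prescribed fibres *)

Lemma eq_run (D : eqType) (X O : Type) (A : query_alg D X O) (f g : D -> X) :
  {in queries A f, f =1 g} -> run A f = run A g.
Proof.
elim: A => [//|x next IH] /= eq_fg.
rewrite -(eq_fg x) ?mem_head //; apply: IH => y yQ.
by apply: eq_fg; rewrite inE yQ orbT.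
Qed.

Lemma card_imset_fibers (T X Y : finType) (Q : {set T}) (g : T -> X)
    (h : T -> Y) :
  {in Q &, forall x y, g x = g y <-> h x = h y} -> #|g @: Q| = #|h @: Q|.
Proof.
move=> gh; pose P := [set (g x, h x) | x in Q].
have -> : g @: Q = fst @: P by rewrite -imset_comp.
have -> : h @: Q = snd @: P by rewrite -imset_comp.
rewrite (@card_in_imset _ _ fst P) ?(@card_in_imset _ _ snd P) //
  => _ _ /imsetP[x xQ ->] /imsetP[y yQ ->] /= e.
  by rewrite e ((gh x y xQ yQ).2 e).
by rewrite e ((gh x y xQ yQ).1 e).
Qed.

(** Fibres of [h] that meet [Q] take the value [g] has there. The others are sent injectively to
    values outside [g @: Q]; enough remain because [g @: Q] and [h @: Q] have the same size. *)
Lemma extend_fibers (T X Y : finType) (h : T -> Y) (Q : {set T}) (g : T -> X) :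
    (#|h @: setT| <= #|X|)%N ->
    {in Q &, forall x y, g x = g y <-> h x = h y} ->
  exists2 f : T -> X, forall x y, f x = f y <-> h x = h y & {in Q, f =1 g}.
Proof.
move=> le_hX gQ; pose A := h @: Q; pose B := ~: (g @: Q).
pose C := h @: setT :\: A.
have sizeC : (size (enum C) <= size (enum B))%N.
  rewrite -!cardE (cardsCs B) setCK (card_imset_fibers gQ) cardsD.
  by rewrite (setIidPr _) ?leq_sub2r // imsetS ?subsetT.
pose f x := if [pick q in Q | h q == h x] is Some q then g q
            else nth (g x) (enum B) (index (h x) (enum C)).
have fQ x q : q \in Q -> h q = h x -> f x = g q.
  move=> qQ hqx; rewrite /f; case: pickP => [r /andP[rQ /eqP hrx]|/(_ q)].
    by apply/(gQ r q rQ qQ); rewrite hrx.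
  by rewrite qQ hqx eqxx.
have fC x : h x \notin A ->
    f x = nth (g x) (enum B) (index (h x) (enum C)) /\ h x \in enum C.
  move=> hxA; split; last by rewrite mem_enum inE hxA imset_f ?inE.
  rewrite /f; case: pickP => // q /andP[qQ /eqP hqx].
  by rewrite -hqx imset_f in hxA.
have indexB x : h x \in enum C -> (index (h x) (enum C) < size (enum B))%N.
  by move=> hxC; rewrite (leq_trans _ sizeC) ?index_mem.
exists f => [x y|q qQ]; last exact: fQ.
split=> [|hxy].
  have [/imsetP[q qQ hxq]|hxA] := boolP (h x \in A);
    have [/imsetP[r rQ hyr]|hyA] := boolP (h y \in A).
  - by rewrite (fQ x q) // (fQ y r) // hxq hyr => /(gQ q r qQ rQ).
  - have [-> hyC] := fC y hyA; rewrite (fQ x q) // => gq.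
    have : g q \in B by rewrite -mem_enum gq mem_nth // indexB.
    by rewrite inE imset_f.
  - have [-> hxC] := fC x hxA; rewrite (fQ y r) // => gr.
    have : g r \in B by rewrite -mem_enum -gr mem_nth // indexB.
    by rewrite inE imset_f.
  - have [-> hxC] := fC x hxA; have [-> hyC] := fC y hyA.
    (* The default [g x] of [nth] varies with [x]; it is never reached, so both sides can be given
       the same one. *)
    rewrite (set_nth_default (g x)) ?indexB // => /eqP.
    rewrite nth_uniq ?enum_uniq ?indexB // => /eqP idx.
    by rewrite -(nth_index (h x) hxC) idx nth_index.
have [/imsetP[q qQ hxq]|hxA] := boolP (h x \in A).
  by rewrite (fQ x q) // (fQ y q) // -hxy.
have [-> hxC] := fC x hxA; have [|-> _] := fC y; first by rewrite -hxy.
by rewrite -hxy; apply/set_nth_default/indexB.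
Qed.

(** * Linear algebra: bases chosen inside a set, and extension of row spaces *)

Lemma spanning_subset (F : finFieldType) (n r : nat) (E : {set 'rV[F]_n})
    (U : 'M[F]_(r, n)) :
    {in E, forall v, (v <= U)%MS} ->
  exists2 B : {set 'rV[F]_n}, B \subset E /\ (#|B| <= \rank U)%N &
    forall (s : nat) (W : 'M[F]_(s, n)),
      {in B, forall v, (v <= W)%MS} -> {in E, forall v, (v <= W)%MS}.
Proof.
move=> sEU; pose A := \matrix_(i < #|E|) (enum_val i : 'rV[F]_n).
have sAU : (A <= U)%MS.
  by apply/row_subP=> i; rewrite rowK sEU ?enum_valP.
(* A maximal free family of rows of [A] consists of elements of [E], spans all of [E], and has size
   [\rank A], at most [\rank U]. *)
exists [set row (maxrankfun A i) A | i : 'I_(\rank A)].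
  split; first by apply/subsetP=> _ /imsetP[i _ ->]; rewrite rowK enum_valP.
  by rewrite (leq_trans (leq_imset_card _ _)) // card_ord mxrankS.
move=> s W sBW v vE; have: (A <= W)%MS.
  rewrite -(eq_maxrowsub A); apply/row_subP=> i; apply: sBW.
  by rewrite row_rowsub; apply: imset_f.
apply: submx_trans; rewrite (eq_row_sub (enum_rank_in vE v)) //.
by rewrite rowK enum_rankK_in.
Qed.

Lemma row_notin (F : fieldType) (r n : nat) (U : 'M[F]_(r, n)) :
  (\rank U < n)%N -> exists v : 'rV[F]_n, ~~ (v <= U)%MS.
Proof.
move=> ltUn; have: ~~ (1%:M <= U)%MS.
  by rewrite sub1mx /row_full neq_ltn ltUn.
by move/row_subPn=> [i ?]; exists (row i 1%:M).
Qed.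

Lemma rank_add_row (F : fieldType) (r n : nat) (U : 'M[F]_(r, n)) (v : 'rV_n) :
  ~~ (v <= U)%MS -> \rank (U + v)%MS = (\rank U).+1.
Proof.
move=> vU; apply/eqP; rewrite eqn_leq; apply/andP; split.
  by rewrite (leq_trans (mxrank_adds_leqif _ _)) //
    -[X in (_ <= X)%N]addn1 leq_add2l rank_leq_row.
rewrite ltnNge; apply: contra vU => le_r.
have := mxrank_leqif_sup (addsmxSl U v); case=> le1 eq1.
have : (U + v <= U)%MS by rewrite -eq1 eqn_leq le1.
exact/submx_trans/addsmxSr.
Qed.

Lemma extend_rank (F : fieldType) (n k : nat) (U : 'M[F]_n) :
    (\rank U <= k <= n)%N ->
  exists2 W : 'M[F]_n, (U <= W)%MS & \rank W = k.
Proof.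
case/andP; elim: k => [|k IH] leUk lekn.
  by exists U => //; apply/eqP; rewrite -leqn0.
move: leUk; rewrite leq_eqVlt ltnS => /orP[/eqP rU|leUk]; first by exists U.
have [W sUW rW] := IH leUk (ltnW lekn).
have [|v vW] := @row_notin _ _ _ W; first by rewrite rW.
exists (W + v)%MS; last by rewrite rank_add_row ?rW.
exact: submx_trans sUW (addsmxSl _ _).
Qed.

(** Enlarge [U] to [W] of rank one less than the target, then add to [W] either [v] outside [W] or
    [w] outside [W + v]. *)
Lemma two_extensions (F : fieldType) (n k : nat) (U : 'M[F]_n) :
    (\rank U < k < n)%N ->
  exists W1 W2 : 'M[F]_n, [/\ (U <= W1)%MS /\ \rank W1 = k,
    (U <= W2)%MS /\ \rank W2 = k & ~~ (W2 <= W1)%MS].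
Proof.
case: k => [//|k] /andP[leUk ltkn].
have [|W sUW rW] := @extend_rank F n k U.
  by rewrite -ltnS leUk ltnW // ltnW.
have [|v vW] := @row_notin _ _ _ W; first by rewrite rW ltnW.
have rv : \rank (W + v)%MS = k.+1 by rewrite rank_add_row ?rW.
have [|w wWv] := @row_notin _ _ _ (W + v)%MS; first by rewrite rv.
have wW : ~~ (w <= W)%MS.
  by apply: contra wWv => /submx_trans; apply; apply: addsmxSl.
exists (W + v)%MS, (W + w)%MS; split.
- by split=> //; apply: submx_trans sUW (addsmxSl _ _).
- by rewrite rank_add_row ?rW //; split=> //;
    apply: submx_trans sUW (addsmxSl _ _).
- by apply: contra wWv; apply: submx_trans; apply: addsmxSr.
Qed.

(** * Counting subgroups from below and small subsets from above *)

Lemma card_rank_subgroups (p k m : nat) : prime p ->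
  (p ^ (k * m) <=
     #|[set S : {group 'rV['F_p]_(k + m)} | subgroup_rank S == k]|)%N.
Proof.
move=> p_pr; pose gr (M : 'M['F_p]_(k, m)) := rowg_group (row_mx 1%:M M).
(* If [row_mx 1 M] and [row_mx 1 M'] have the same row space, the left blocks force the change of
   basis to be the identity. *)
have inj_gr : injective gr.
  move=> M M' /(congr1 (@gval _)) /= /eqP; rewrite eqEsubset rowgS => /andP[].
  case/submxP=> X; rewrite mul_mx_row => /eq_row_mx[].
  by rewrite mulmx1 => <-; rewrite mul1mx.
rewrite -{1}(card_Fp p_pr) -card_mx -cardsT -(card_imset _ inj_gr).
apply/subset_leq_card/subsetP=> _ /imsetP[M _ ->].
rewrite inE /subgroup_rank rowgK; apply/row_freeP; exists (col_mx 1%:M 0).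
by rewrite mul_row_col mulmx1 mulmx0 addr0.
Qed.

(** Expand the power over subsets of [D]: a subset [B] contributes [x ^+ #|B|], which is at least
    [x ^+ k] when [#|B| <= k], since [x <= 1]. *)
Lemma card_small_subsets (R : realType) (T : finType) (D : {set T}) (k : nat)
    (x : R) : 0 <= x <= 1 ->
  #|[set B : {set T} | B \subset D & (#|B| <= k)%N]|%:R * x ^+ k
    <= (1 + x) ^+ #|D|.
Proof.
move=> /andP[x0 x1]; set P := [set B | _ & _].
(* The factor [x *+ (i \in D)] vanishes off [D], so the sum may range over all subsets of the
   type. *)
have -> : (1 + x) ^+ #|D| =
    \sum_(B in {set T}) \prod_i (if i \in B then x *+ (i \in D) else 1).
  rewrite -bigA_distr -prodr_const big_mkcond.
  by apply: eq_bigr => i _; case: ifP => _ /=; rewrite ?add0r // addrC.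
have term_ge0 B : 0 <= \prod_i (if i \in B then x *+ (i \in D) else 1) :> R.
  by apply: prodr_ge0 => i _; case: ifP => // _; rewrite mulrn_wge0.
rewrite (bigID (mem P)) /= -[X in X <= _]addr0 lerD ?sumr_ge0 //.
rewrite mulr_natl -sumr_const ler_sum // => B; rewrite inE => /andP[BD leBk].
rewrite -big_mkcond /= (eq_bigr (fun=> x)); last first.
  by move=> i iB; rewrite (subsetP BD).
by rewrite prodr_const ler_wiXn2l.
Qed.

(** * Subgroups that the algorithm cannot tell apart *)

Lemma mem_subgroup (p n : nat) (S : {group 'rV['F_p]_n}) v :
  (v \in S) = (v <= rowg_mx S)%MS.
Proof. by rewrite -{1}(rowg_mxK S) mem_rowg. Qed.

Lemma card_cosets (p n : nat) (S : {group 'rV['F_p]_n}) : prime p ->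
  #|(mulmxr (cokermx (rowg_mx S)) : 'rV_n -> 'rV_n) @: setT|
    = (p ^ (n - subgroup_rank S))%N.
Proof.
move=> p_pr; rewrite /subgroup_rank -mxrank_coker.
rewrite -[X in (X ^ _)%N](card_Fp p_pr).
rewrite -card_rowg; apply: eq_card => v; rewrite inE.
by apply/imsetP/submxP=> [[u _ ->]|[u ->]]; exists u.
Qed.

(** The instance [f] ensures that [X] has enough values to hide any rank-[k] subgroup, and its
    queries represent those of every oracle. *)
Lemma hidden_subgroup_inj (p n k : nat) (X : finType)
    (A : query_alg 'rV['F_p]_n X {group 'rV['F_p]_n}) (f : 'rV['F_p]_n -> X)
    (S1 S2 : {group 'rV['F_p]_n}) :
    prime p -> nonadaptive A -> solves_GSP k A -> GSP_instance k f ->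
    subgroup_rank S1 = k -> subgroup_rank S2 = k ->
    {in queries A f &, forall x y, (x - y \in S1) = (x - y \in S2)} ->
  S1 = S2.
Proof.
move=> p_pr naA solA [S [rS fS]] r1 r2 eqS.
pose h (U : {group 'rV['F_p]_n}) := mulmxr (cokermx (rowg_mx U)) : 'rV_n -> 'rV_n.
have hP U x y : h U x = h U y <-> x - y \in U.
  rewrite mem_subgroup submxE mulmxBl subr_eq0.
  by split=> /eqP.
have cardX U : subgroup_rank U = k -> (#|h U @: setT| <= #|X|)%N.
  move=> rU; rewrite card_cosets // rU -rS -card_cosets //.
  rewrite -(@card_imset_fibers _ _ _ _ f); first exact: max_card.
  by move=> x y _ _; split=> [/fS/hP|/hP/fS].
pose Q := [set x in queries A f].
(* With no prescribed points this yields some [f1] hiding [S1]; next, its restriction to [Q] is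
   extended to [f2] hiding [S2]. *)
have [|f1 f1h _] := @extend_fibers _ _ _ (h S1) set0 f (cardX S1 r1).
  by move=> x y; rewrite inE.
have [|f2 f2h f2f1] := @extend_fibers _ _ _ (h S2) Q f1 (cardX S2 r2).
  move=> x y; rewrite !inE => xQ yQ.
  by split=> [/f1h/hP|/hP] xy; [apply/hP | apply/f1h/hP]; rewrite (eqS, =^~ eqS).
rewrite -(solA f1 S1 r1); last by move=> x y; split=> [/f1h/hP|/hP/f1h].
rewrite -(solA f2 S2 r2); last by move=> x y; split=> [/f2h/hP|/hP/f2h].
by apply: eq_run => x; rewrite (naA f1 f) => xQ; rewrite f2f1 ?inE.
Qed.

Lemma rank_le_queries (p n k : nat) (X : finType)
    (A : query_alg 'rV['F_p]_n X {group 'rV['F_p]_n}) (f : 'rV['F_p]_n -> X) :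
    prime p -> (k < n)%N -> nonadaptive A -> solves_GSP k A ->
    GSP_instance k f ->
  (k <= size (queries A f))%N.
Proof.
move=> p_pr ltkn naA solA fI; rewrite leqNgt; apply/negP => ltQk.
set Q := queries A f in ltQk.
pose U := (<<\matrix_(i < size Q) nth 0 Q i>>)%MS.
have QU x : x \in Q -> (x <= U)%MS.
  move=> xQ; rewrite genmxE; have ltx : (index x Q < size Q)%N by rewrite index_mem.
  by rewrite (eq_row_sub (Ordinal ltx)) // rowK nth_index.
have [|W1 [W2 [[sW1 r1] [sW2 r2] /negP[]]]] := @two_extensions _ n k U.
  by rewrite (leq_ltn_trans _ ltQk) // genmxE rank_leq_row.
rewrite -rowgS -[rowg W2]/(gval (rowg_group W2)).
suff -> : rowg_group W2 = rowg_group W1 by [].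
apply: (hidden_subgroup_inj p_pr naA solA fI); rewrite /subgroup_rank ?rowgK //.
have sub W : (U <= W)%MS -> {in Q &, forall x y, x - y \in rowg_group W}.
  move=> sUW x y xQ yQ; rewrite mem_rowg.
  by apply: submx_trans sUW; rewrite addmx_sub ?eqmx_opp ?QU.
by move=> x y xQ yQ; rewrite !sub.
Qed.

Lemma card_subgroups_le_subsets (p n k : nat) (X : finType)
    (A : query_alg 'rV['F_p]_n X {group 'rV['F_p]_n}) (f : 'rV['F_p]_n -> X)
    (D := [set x - y | x in queries A f, y in queries A f]) :
    prime p -> nonadaptive A -> solves_GSP k A -> GSP_instance k f ->
  (#|[set S : {group 'rV['F_p]_n} | subgroup_rank S == k]|
     <= #|[set B : {set 'rV['F_p]_n} | B \subset D & (#|B| <= k)%N]|)%N.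
Proof.
move=> p_pr naA solA fI.
(* The property is boolean, the quantifier ranging over a finite type of groups, so that [xchoose]
   can select a basis for each [S]. *)
have spanS (S : {group 'rV['F_p]_n}) : exists B : {set 'rV['F_p]_n},
    [&& B \subset D :&: S, (#|B| <= subgroup_rank S)%N &
        [forall S' : {group 'rV['F_p]_n}, (B \subset S') ==> (D :&: S \subset S')]].
  have [|B [sBE leB] spB] := @spanning_subset _ _ _ (D :&: S) (rowg_mx S).
    by move=> v /setIP[_]; rewrite mem_subgroup.
  exists B; rewrite sBE leB; apply/forallP=> S'; apply/implyP=> /subsetP sBS'.
  apply/subsetP=> v vE; rewrite mem_subgroup; apply: spB vE => u uB.
  by rewrite -mem_subgroup sBS'.
pose b S := xchoose (spanS S).
have bP S := xchooseP (spanS S).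
rewrite -(@card_in_imset _ _ b).
  apply/subset_leq_card/subsetP=> _ /imsetP[S /[!inE] /eqP rS ->].
  have /and3P[+ + _] := bP S; rewrite -/(b S) rS => sB ->; rewrite andbT.
  exact: subset_trans sB (subsetIl _ _).
move=> S1 S2 /[!inE] /eqP r1 /eqP r2 eqb.
(* The common basis lies in [S'], hence so does everything it spans, in particular [D :&: S]. *)
have half S S' : b S = b S' -> D :&: S \subset S'.
  move=> eb; have /and3P[_ _ /forallP/(_ S')/implyP] := bP S.
  rewrite -/(b S) eb; apply; have /and3P[sB _ _] := bP S'.
  exact: subset_trans sB (subsetIr _ _).
apply: (hidden_subgroup_inj p_pr naA solA fI) => // x y xQ yQ.
have xyD : x - y \in D by apply: imset2_f.
by apply/idP/idP=> xyS; [apply: (subsetP (half S1 S2 _))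
  | apply: (subsetP (half S2 S1 _))] => //; rewrite inE xyD.
Qed.

(** * The numerical bounds *)

Lemma queries_sqr_bound (R : realType) (p k m : nat) (X : finType)
    (A : query_alg 'rV['F_p]_(k + m) X {group 'rV['F_p]_(k + m)})
    (f : 'rV['F_p]_(k + m) -> X) :
    prime p -> (0 < k)%N -> (0 < m)%N -> nonadaptive A -> solves_GSP k A ->
    GSP_instance k f ->
  (k * p ^ m)%:R <= expR 1 * (size (queries A f))%:R ^+ 2 :> R.
Proof.
move=> p_pr k0 m0 naA solA fI; set q := size _.
have le_kq : (k <= q)%N.
  by apply: (@rank_le_queries p (k + m)); rewrite // -addn1 leq_add2l.
have q0 : (0 < q)%N := leq_trans k0 le_kq.
pose D := [set x - y | x in queries A f, y in queries A f].
have leD : (#|D| <= q ^ 2)%N.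
  pose Q := [set x in queries A f].
  have -> : D = [set u.1 - u.2 | u in setX Q Q].
    apply/setP=> v; apply/imset2P/imsetP=> [[x y xQ yQ ->]|[[x y]]].
      by exists (x, y); rewrite // !inE xQ.
    by rewrite !inE => /andP[xQ yQ] ->; exists x y.
  rewrite (leq_trans (leq_imset_card _ _)) // cardsX -mulnn.
  by rewrite leq_mul // cardsE card_size.
(* With this [x], [(1 + x) ^+ (q ^ 2)] is at most the exponential of [x * q ^ 2 = k]. Both sides of
   [key] are then [k]-th powers, and the root can be taken. *)
pose x : R := k%:R / (q ^ 2)%:R.
have q2_gt0 : 0 < (q ^ 2)%:R :> R by rewrite ltr0n expn_gt0 q0.
have x_gt0 : 0 < x by rewrite divr_gt0 // ltr0n.
have x_le1 : x <= 1.
  by rewrite ler_pdivrMr // mul1r ler_nat (leq_trans le_kq) // leq_pmulr.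
have key : ((p ^ m)%:R * x) ^+ k <= expR 1 ^+ k.
  rewrite exprMn -natrX -expnM mulnC.
  apply: le_trans (_ : (1 + x) ^+ (q ^ 2) <= _); last first.
    apply: le_trans (_ : expR x ^+ (q ^ 2) <= _).
      by rewrite lerXn2r ?expR_ge1Dx // nnegrE ?expR_ge0 // addr_ge0 // ltW.
    by rewrite -!expRM_natl mulr1 mulrC divfK // gt_eqF.
  apply: le_trans (_ : (1 + x) ^+ #|D| <= _); last first.
    by rewrite ler_weXn2l // lerDl ltW.
  apply: le_trans (card_small_subsets D k (x := x) _); last by rewrite ltW.
  rewrite ler_wpM2r ?exprn_ge0 ?(ltW x_gt0) // ler_nat.
  exact: leq_trans (card_rank_subgroups _ _ p_pr)
    (card_subgroups_le_subsets p_pr naA solA fI).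
have: (p ^ m)%:R * x <= expR 1.
  by rewrite -(ler_pXn2r k0) ?nnegrE ?expR_ge0 // mulr_ge0 // ltW.
rewrite mulrA ler_pdivrMr // (natrX _ q).
by rewrite natrM [k%:R * _]mulrC.
Qed.

Theorem theorem2 (R : realType) :
  exists2 c : R, 0 < c &
    forall p n k : nat, prime p -> (0 < k)%N -> (k < n)%N ->
    forall (X : finType)
           (A : query_alg 'rV['F_p]_n X {group 'rV['F_p]_n}),
      nonadaptive A -> solves_GSP k A ->
      forall f : 'rV['F_p]_n -> X, GSP_instance k f ->
        c * Num.max (k%:R) (Num.sqrt ((k * p ^ (n - k))%N%:R))
          <= (size (queries A f))%:R.
Proof.
have e_ge1 : 1 <= expR 1 :> R.
  by rewrite (le_trans _ (expR_ge1Dx 1)) // lerDl.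
(* The square bound alone would allow the inverse square root of e; since e is at least 1, its
   inverse also works and suits both terms of the maximum. *)
exists (expR 1)^-1 => [|p n k p_pr k0 ltkn X A naA solA f fI].
  by rewrite invr_gt0 expR_gt0.
set q := size _; rewrite ler_pdivrMl ?expR_gt0 // ge_max; apply/andP; split.
  rewrite (le_trans (_ : _ <= q%:R)) ?ler_peMl //.
  by rewrite ler_nat (rank_le_queries p_pr ltkn).
rewrite -[leRHS]ger0_norm ?mulr_ge0 ?expR_ge0 // -sqrtr_sqr ler_wsqrtr //.
(* The block matrices in the count require the dimension to be literally a sum [k + m]. *)
have [m [m0 n_eq]] : exists m, (0 < m)%N /\ n = (k + m)%N.
  by exists (n - k)%N; rewrite subn_gt0 subnKC // ltnW.
move: A f naA solA fI @q; rewrite {}n_eq addKn => A f naA solA fI q.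
rewrite (le_trans (queries_sqr_bound R p_pr k0 m0 naA solA fI)) // -/q.
by rewrite exprMn ler_wpM2r ?sqr_ge0 // expr2 ler_peMr ?expR_ge0.
Qed.
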